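(* Let $k \geq 1$ be an integer and $\epsilon>0$ a real number. Let $G$ be a finite abelian group of order $n > \frac{2^{10}k^8}{\epsilon^8}$ with $k<n$, and let $A$ be a subset of $G$ chosen uniformly at random among all subsets of $G$ of size $m=\lceil \frac{4k^2 \log n}{\epsilon^2}\rceil$ (where $\log$ is the natural logarithm). Then $$\Pr\big[\,\mu_{k-1}(X_{A,k}) < (1-\epsilon)m\,\big] < \frac{6}{n}.$$
   Context: Let $G$ be a finite abelian group of order $n$ and let $\Delta_{n-1}$ be the $(n-1)$-simplex on the vertex set $G$. For $A \subset G$ and $k<n$, the sum complex $X_{A,k}$ is the $k$-dimensional simplicial complex consisting of the full $(k-1)$-skeleton of $\Delta_{n-1}$ together with all $(k+1)$-subsets $\sigma \subset G$ with $\sum_{x\in\sigma} x \in A$. For a finite simplicial complex $X$ and $j\ge 0$, let $X(j)$ be the set of $j$-simplices of $X$, each with an arbitrary fixed orientation. A $j$-cochain is a complex-valued skew-symmetric function on ordered $j$-simplices of $X$; $C^j(X)$ is the space of $j$-cochains, with inner product $(\phi,\psi)_X=\sum_{\sigma\in X(j)}\phi(\sigma)\overline{\psi(\sigma)}$. Set $C^{-1}(X)=\mathbb{C}$. The coboundary $d_j:C^j(X)\to C^{j+1}(X)$ is $d_j\phi([v_0,\dots,v_{j+1}])=\sum_{i=0}^{j+1}(-1)^i\phi([v_0,\dots,\widehat{v_i},\dots,v_{j+1}])$ for $j\ge 0$, and $d_{-1}(a)(v)=a$. Let $d_j^*$ be the adjoint of $d_j$ with respect to these inner products. The reduced $j$-th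 Laplacian is $L_j(X)=d_{j-1}d_{j-1}^*+d_j^*d_j$ on $C^j(X)$ (for $j\ge 0$), and $\mu_j(X)$ denotes its minimal eigenvalue. *)

(* Defs.v *)
From HB Require Import structures.
From mathcomp Require Import all_boot all_order all_algebra all_fingroup.
From mathcomp Require Import complex.
From mathcomp Require classical_sets.
From mathcomp Require Import reals exp.
Set Implicit Arguments.
Unset Strict Implicit.
Unset Printing Implicit Defensive.
Import Order.TTheory GRing.Theory Num.Theory.
Local Open Scope ring_scope.

(* The empty set is always a face: it is the only (-1)-simplex. *)
Record simplicial_complex (V : finType) := SimplicialComplex {
  faces :> {set {set V}};
  faces_set0 : set0 \in faces;
  faces_sub : forall s t : {set V}, s \subset t -> t \in faces -> s \in faces
}.

(* Ordered simplices with p vertices, i.e. of dimension p - 1. *)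
Definition is_osimplex (V : finType) (X : simplicial_complex V) p
    (t : {ffun 'I_p -> V}) : bool :=
  injectiveb t && ([set t i | i : 'I_p] \in faces X).

Definition osimplex (V : finType) (X : simplicial_complex V) p : finType :=
  {t : {ffun 'I_p -> V} | is_osimplex X t}.

Section OrderedSimplices.
Variables (V : finType) (X : simplicial_complex V).

Definition support_of p (t : osimplex X p) : {set V} :=
  [set val t i | i : 'I_p].

Fact reorder_subproof p (s : 'S_p) (t : osimplex X p) :
  is_osimplex X [ffun i => val t (s i)].
Proof.
case: t => t /= /andP[/injectiveP t_inj tX]; apply/andP; split.
  by apply/injectiveP => i j; rewrite !ffunE => /t_inj /perm_inj.
apply: faces_sub tX; apply/subsetP => _ /imsetP[i _ ->].
by rewrite ffunE imset_f.
Qed.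

Definition reorder p (s : 'S_p) (t : osimplex X p) : osimplex X p :=
  exist _ [ffun i => val t (s i)] (reorder_subproof s t).

Fact del_subproof p (i : 'I_p.+1) (t : osimplex X p.+1) :
  is_osimplex X [ffun l : 'I_p => val t (lift i l)].
Proof.
case: t => t /= /andP[/injectiveP t_inj tX]; apply/andP; split.
  by apply/injectiveP => l j; rewrite !ffunE => /t_inj /lift_inj.
apply: faces_sub tX; apply/subsetP => _ /imsetP[l _ ->].
by rewrite ffunE imset_f.
Qed.

Definition del p (i : 'I_p.+1) (t : osimplex X p.+1) : osimplex X p :=
  exist _ [ffun l : 'I_p => val t (lift i l)] (del_subproof i t).

Lemma reorderM p (s r : 'S_p) (t : osimplex X p) :
  reorder s (reorder r t) = reorder (s * r)%g t.
Proof. by apply/val_inj/ffunP => i; rewrite !ffunE permM. Qed.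

Lemma reorder1 p (t : osimplex X p) : reorder 1%g t = t.
Proof. by apply/val_inj/ffunP => i; rewrite !ffunE perm1. Qed.

Lemma reorder_eqE p (s : 'S_p) (t u : osimplex X p) :
  (reorder s t == u) = (t == reorder s^-1%g u).
Proof.
by apply/eqP/eqP => [<-|->]; rewrite reorderM ?mulVg ?mulgV reorder1.
Qed.

Lemma osimplex_inj p (t : osimplex X p) : injective (val t).
Proof. by case/andP: (valP t) => /injectiveP. Qed.

Lemma reorder_injl p (t : osimplex X p) : injective (fun s => reorder s t).
Proof.
move=> s r /(congr1 val)/ffunP e; apply/permP => i.
by have := e i; rewrite !ffunE => /osimplex_inj.
Qed.

Lemma support_reorder p (s : 'S_p) (t : osimplex X p) :
  support_of (reorder s t) = support_of t.
Proof.
apply/setP => x; apply/imsetP/imsetP => -[i _ ->].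
  by exists (s i) => //; rewrite ffunE.
by exists ((s^-1)%g i) => //; rewrite ffunE permKV.
Qed.

Lemma support_ofP p (t u : osimplex X p) :
  support_of t = support_of u -> exists s, u = reorder s t.
Proof.
move=> e; have ex i : exists j, val u i == val t j.
  have : val u i \in support_of t by rewrite e imset_f.
  by case/imsetP => j _ ->; exists j.
have exE i : val u i = val t (xchoose (ex i)) by apply/eqP/(xchooseP (ex i)).
have s_inj : injective (fun i => xchoose (ex i)).
  by move=> i j /(congr1 (val t)); rewrite -!exE => /osimplex_inj.
by exists (perm s_inj); apply/val_inj/ffunP => i; rewrite ffunE permE.
Qed.

Lemma support_of_face p (t : osimplex X p) :
  (support_of t \in faces X) && (#|support_of t| == p).
Proof.
rewrite card_imset ?card_ord ?eqxx ?andbT; last exact: osimplex_inj.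
by case/andP: (valP t).
Qed.

Lemma ex_osimplex p (sigma : {set V}) :
  sigma \in faces X -> #|sigma| = p ->
  exists t : osimplex X p, support_of t = sigma.
Proof.
move=> sX sp; pose t := [ffun i : 'I_p => enum_val (cast_ord (esym sp) i)].
have tE : [set t i | i : 'I_p] = sigma.
  apply/setP => x; apply/imsetP/idP => [[i _ ->]|xs].
    by rewrite ffunE enum_valP.
  exists (cast_ord sp (enum_rank_in xs x)) => //.
  by rewrite ffunE cast_ordK enum_rankK_in.
have tP : is_osimplex X t.
  rewrite /is_osimplex tE sX andbT; apply/injectiveP => i j.
  by rewrite !ffunE => /enum_val_inj/cast_ord_inj.
by exists (exist _ t tP).
Qed.

End OrderedSimplices.

Section Cochains.
Variables (R : realType) (V : finType) (X : simplicial_complex V).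
Local Notation C := (R[i]).

Local Notation fct p := {ffun osimplex X p -> C^o}.

Definition skew_defect p (phi : fct p) : {ffun 'S_p * osimplex X p -> C^o} :=
  [ffun st => phi (reorder st.1 st.2) - (-1) ^+ st.1 * phi st.2].

Fact skew_defect_is_linear p : linear (@skew_defect p).
Proof.
move=> a f g; apply/ffunP => st; rewrite !ffunE /= /GRing.scale /=.
by rewrite mulrDr mulrBr opprD addrACA mulrCA.
Qed.

HB.instance Definition _ p := GRing.isSemilinear.Build C (fct p)
  {ffun 'S_p * osimplex X p -> C^o} _ (@skew_defect p)
  (GRing.semilinear_linear (@skew_defect_is_linear p)).

(* The space C^(p-1)(X): its elements live on ordered simplices with p       *)
(* vertices. In particular p = 0 gives C^(-1)(X), which is a line since the  *)
(* empty tuple is the only ordered simplex without vertices.                 *)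
Definition skew_space p : {vspace fct p} := lker (linfun (@skew_defect p)).

Definition cochain p : vectType C := subvs_of (skew_space p).

Definition ev p (phi : cochain p) (t : osimplex X p) : C := vsval phi t.

Lemma skew_spaceP p (phi : fct p) :
  reflect (forall s t, phi (reorder s t) = (-1) ^+ s * phi t)
          (phi \in skew_space p).
Proof.
rewrite memv_ker lfunE /=; apply: (iffP eqP) => [/ffunP e s t | e].
  by move: (e (s, t)); rewrite !ffunE /= => /eqP; rewrite subr_eq0 => /eqP.
by apply/ffunP => -[s t]; rewrite !ffunE /= e subrr.
Qed.

Definition coboundary_fct p (phi : fct p) : fct p.+1 :=
  [ffun t => \sum_(i < p.+1) (-1) ^+ i * phi (del i t)].

Fact coboundary_fct_is_linear p : linear (@coboundary_fct p).
Proof.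
move=> a f g; apply/ffunP => t; rewrite !ffunE /= /GRing.scale /=.
rewrite mulr_sumr -big_split; apply: eq_bigr => i _ /=.
by rewrite !ffunE mulrDr mulrCA.
Qed.

Fact coboundary_subproof p (phi : cochain p) :
  coboundary_fct (vsval phi) \in skew_space p.+1.
Proof.
case: phi => phi /= /skew_spaceP phi_skew; apply/skew_spaceP => s t.
rewrite !ffunE mulr_sumr [RHS](reindex_inj (@perm_inj _ s)) /=.
apply: eq_bigr => i _.
pose u_fun l := odflt l (unlift (s i) (s (lift i l))).
have uE l : lift (s i) (u_fun l) = s (lift i l).
  rewrite /u_fun; have [j -> //|/perm_inj/eqP] := unliftP (s i) (s (lift i l)).
  by rewrite eq_sym (negPf (neq_lift _ _)).
have u_inj : injective u_fun.
  by move=> l j /(congr1 (lift (s i))); rewrite !uE => /perm_inj/lift_inj.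
pose u := perm u_inj.
have sE : s = lift_perm i (s i) u.
  apply/permP => j; have [l ->|->] := unliftP i j; last by rewrite lift_perm_id.
  by rewrite lift_perm_lift permE uE.
have -> : del i (reorder s t) = reorder u (del (s i) t).
  by apply/val_inj/ffunP => l; rewrite !ffunE permE uE.
rewrite phi_skew !mulrA; congr (_ * _).
have -> : (-1) ^+ s = (-1) ^+ i * (-1) ^+ s i * (-1) ^+ u :> C.
  rewrite {1}sE odd_lift_perm signr_addb; congr (_ * _).
  by rewrite signr_addb !signr_odd.
by rewrite [RHS]mulrAC; congr (_ * _); rewrite -mulrA -expr2 sqrr_sign mulr1.
Qed.

Definition coboundary_fun p (phi : cochain p) : cochain p.+1 :=
  Subvs (coboundary_subproof phi).

Fact coboundary_fun_is_linear p : linear (@coboundary_fun p).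
Proof. by move=> a f g; apply/val_inj/coboundary_fct_is_linear. Qed.

HB.instance Definition _ p := GRing.isSemilinear.Build C (cochain p)
  (cochain p.+1) _ (@coboundary_fun p)
  (GRing.semilinear_linear (@coboundary_fun_is_linear p)).

(* d_(p-1) : C^(p-1)(X) -> C^p(X). *)
Definition coboundary p : 'Hom(cochain p, cochain p.+1) :=
  linfun (@coboundary_fun p).

(* [pick] fixes an orientation of each simplex. *)
Definition orientation p (sigma : {set V}) : option (osimplex X p) :=
  [pick t | support_of t == sigma].

Definition cdot p (phi psi : cochain p) : C :=
  \sum_(sigma in faces X | #|sigma| == p)
     oapp (fun t => ev phi t * Num.conj (ev psi t)) 0
          (orientation p sigma).

Lemma evP p (phi : cochain p) s t :
  ev phi (reorder s t) = (-1) ^+ s * ev phi t.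
Proof. exact/skew_spaceP/subvsP. Qed.

(* The inner product does not depend on the chosen orientations. *)
Lemma cdotE p (phi psi : cochain p) :
  cdot phi psi =
  (p`!%:R)^-1 * \sum_(t : osimplex X p) ev phi t * Num.conj (ev psi t).
Proof.
have pN0 : (p`!%:R : C) != 0 by rewrite pnatr_eq0 -lt0n fact_gt0.
apply: (canRL (mulKf pN0)); rewrite mulr_sumr.
rewrite (partition_big (@support_of _ X p)
  (fun sigma => (sigma \in faces X) && (#|sigma| == p))) /=; last first.
  by move=> t _; exact: support_of_face.
apply: eq_bigr => sigma /andP[sX /eqP sp]; rewrite /orientation.
case: pickP => [t0 /eqP t0s | no]; last first.
  by have [t /eqP] := ex_osimplex sX sp; rewrite no.
rewrite /= (reindex_onto (fun s => reorder s t0)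
  (fun t => odflt 1%g [pick s | reorder s t0 == t])) /=; last first.
  move=> t /eqP ts; have [s ->] := support_ofP (etrans t0s (esym ts)).
  by case: pickP => [r /eqP //|/(_ s)]; rewrite eqxx.
rewrite (eq_bigl xpredT) => [|s]; last first.
  rewrite support_reorder t0s eqxx /=; case: pickP => [r /eqP/reorder_injl -> |].
    by rewrite eqxx.
  by move/(_ s); rewrite eqxx.
rewrite (eq_bigr (fun=> ev phi t0 * Num.conj (ev psi t0))) => [|s _].
  by rewrite sumr_const card_Sn mulr_natl.
rewrite !evP rmorphM rmorph_sign mulrACA -expr2 sqrr_sign.
by rewrite mul1r.
Qed.

Definition elem_fct p (t : osimplex X p) : fct p :=
  [ffun u => \sum_(s : 'S_p) (-1) ^+ s * (u == reorder s t)%:R].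

Lemma elem_skew p (t : osimplex X p) : elem_fct t \in skew_space p.
Proof.
apply/skew_spaceP => r u; rewrite !ffunE mulr_sumr.
rewrite (reindex_inj (mulgI r)) /=; apply: eq_bigr => s _.
rewrite odd_permM signr_addb -mulrA reorder_eqE reorderM mulgA mulVg mul1g.
by [].
Qed.

Definition elem p (t : osimplex X p) : cochain p := Subvs (elem_skew t).

Lemma elem_reorder p (r : 'S_p) (t : osimplex X p) :
  elem (reorder r t) = (-1) ^+ r *: elem t.
Proof.
apply/val_inj/ffunP => u; rewrite !ffunE /= /GRing.scale /= mulr_sumr.
rewrite [RHS](reindex_inj (mulIg r)) /=; apply: eq_bigr => s _.
rewrite reorderM odd_permM signr_addb !mulrA; congr (_ * _).
by rewrite mulrAC -expr2 sqrr_sign mul1r.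
Qed.

Lemma elem_sum p (phi : cochain p) :
  phi = (p`!%:R : C)^-1 *: \sum_t ev phi t *: elem t.
Proof.
have pN0 : (p`!%:R : C) != 0 by rewrite pnatr_eq0 -lt0n fact_gt0.
apply: (canRL (scalerK _)) => //; apply/val_inj/ffunP => u.
rewrite linear_sum sum_ffunE /= ffunE.
rewrite (eq_bigr (fun t => \sum_(s : 'S_p)
  (-1) ^+ s * (u == reorder s t)%:R * ev phi t)); last first.
  by move=> t _; rewrite !ffunE /GRing.scale /= mulrC mulr_suml.
rewrite exchange_big /= (eq_bigr (fun=> ev phi u)) => [|s _].
  by rewrite sumr_const card_Sn /GRing.scale /= mulr_natl.
rewrite (bigD1 (reorder s^-1%g u)) //= big1 ?addr0 => [|t tu].
  rewrite reorderM mulgV reorder1 eqxx mulr1 evP odd_permV mulrA -expr2.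
  by rewrite sqrr_sign mul1r.
by rewrite [u == _]eq_sym reorder_eqE (negPf tu) mulr0 mul0r.
Qed.

Lemma cdot_linearl p (psi : cochain p) : linear (fun phi => cdot phi psi : C^o).
Proof.
move=> a f g; rewrite /cdot /= /GRing.scale /= mulr_sumr -big_split.
apply: eq_bigr => sigma _ /=; case: orientation => [t|] /=; last first.
  by rewrite mulr0 addr0.
by rewrite /ev /= !ffunE mulrDl /GRing.scale /= mulrA.
Qed.

Definition adjoint p q (f : 'Hom(cochain p, cochain q)) :
    'Hom(cochain q, cochain p) :=
  classical_sets.xget 0 (fun g : 'Hom(cochain q, cochain p) =>
    forall phi psi, cdot (f phi) psi = cdot phi (g psi)).

Lemma adjointP p q (f : 'Hom(cochain p, cochain q)) phi psi :
  cdot (f phi) psi = cdot phi (adjoint f psi).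
Proof.
rewrite /adjoint; case: classical_sets.xgetP => [g _ gP|no]; first exact: gP.
have cdotZl r a (x y : cochain r) : cdot (a *: x) y = a * cdot x y.
  rewrite /cdot mulr_sumr; apply: eq_bigr => sigma _.
  case: orientation => [t|] /=; last by rewrite mulr0.
  by rewrite /ev /= !ffunE /GRing.scale /= mulrA.
have cdot_suml r (I : finType) (F : I -> cochain r) y :
    cdot (\sum_i F i) y = \sum_i cdot (F i) y.
  apply: (big_morph (fun x => cdot x y)) => [x1 x2|].
    by have := cdot_linearl y 1 x1 x2; rewrite !scale1r.
  by rewrite -(scale0r 0) cdotZl mul0r.
have cdotC r (x y : cochain r) : cdot x y = Num.conj (cdot y x).
  rewrite !cdotE rmorphM fmorphV rmorph_nat rmorph_sum; congr (_ * _).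
  by apply: eq_bigr => t _; rewrite rmorphM /= conjCK mulrC.
pose h y : fct p := [ffun t => cdot y (f (elem t))].
have h_skew y : h y \in skew_space p.
  apply/skew_spaceP => s t; rewrite !ffunE elem_reorder linearZ /=.
  by rewrite cdotC cdotZl rmorphM rmorph_sign /= -cdotC.
have h_lin : linear (fun y => Subvs (h_skew y)).
  by move=> a x y; apply/val_inj/ffunP => t; rewrite !ffunE cdot_linearl.
pose hL := GRing.isSemilinear.Build C (cochain q) (cochain p) _ _
  (GRing.semilinear_linear h_lin).
pose gL : {linear cochain q -> cochain p} :=
  HB.pack (fun y => Subvs (h_skew y) : cochain p) hL.
pose g := linfun gL.
case: (no g) => x y; rewrite lfunE /= {1}[x]elem_sum linearZ linear_sum /=.
rewrite cdotZl cdot_suml cdotE; congr (_ * _); apply: eq_bigr => t _.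
by rewrite linearZ /= cdotZl /ev ffunE -cdotC.
Qed.

(* The reduced Laplacian on C^j(X) for j >= 0. *)
Definition laplacian j : 'End(cochain j.+1) :=
  (coboundary j \o adjoint (coboundary j))%VF
  + (adjoint (coboundary j.+1) \o coboundary j.+1)%VF.

(* On R[i], a <= b means that b - a is a nonnegative real. *)
Definition mu j : R :=
  classical_sets.xget 0 (fun x : R => passmx.leigenvalue (laplacian j) x%:C%C /\
    forall a : C, passmx.leigenvalue (laplacian j) a -> x%:C%C <= a).

End Cochains.

Section SumComplex.
Variables (G : finZmodType) (A : {set G}) (k : nat).

Definition sum_faces : {set {set G}} :=
  [set s : {set G} | (#|s| <= k)%N || (#|s| == k.+1) && (\sum_(x in s) x \in A)].

Fact sum_faces_set0 : set0 \in sum_faces.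
Proof. by rewrite inE cards0. Qed.

Fact sum_faces_sub (s t : {set G}) :
  s \subset t -> t \in sum_faces -> s \in sum_faces.
Proof.
rewrite subEproper => /predU1P[-> //|st].
have lt_st := proper_card st; rewrite !inE => /orP[le_tk|/andP[/eqP tE _]].
  by rewrite (leq_trans (ltnW lt_st) le_tk).
by rewrite tE ltnS in lt_st; rewrite lt_st.
Qed.

Definition sum_complex : simplicial_complex G :=
  SimplicialComplex sum_faces_set0 sum_faces_sub.

End SumComplex.

(* Probability of the event E when an element of Omega is drawn uniformly. *)
Definition uniform_pr (R : realType) (T : finType) (Omega E : {set T}) : R :=
  #|Omega :&: E|%:R / #|Omega|%:R.

(* Main.v *)
(* Two estimates combine. Spectral: extend a (k-1)-cochain phi by zero to all
   ordered k-tuples and expand |d phi|^2 over the tuples with sum in A. The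
   diagonal terms give m |phi|^2, and the cross terms are the quadratic forms with
   matrix 1_A(u + v + s) of the functions u |-> phi(u, w). In the Fourier basis
   the trivial character contributes (m/n) |d* phi|^2, which the other half of the
   Laplacian absorbs, and the others at most k lam |phi|^2, where lam bounds the
   nontrivial Fourier coefficients of 1_A. Hence mu_(k-1) >= m - k lam.

   Probabilistic: for a nontrivial character and a random m-set A, let S be the
   sum of the character over A. Drawing the elements of A one by one, the mean of
   cosh(l |S|) grows at each step by a factor at most cosh l, so
   Pr[|S| > t] <= 2 exp(- t^2 / 2m). With t = eps m / k this is at most 2 / n^2,
   and a union bound over the characters gives 2 / n. *)
Require Import Defs.
From mathcomp Require Import all_boot all_order all_algebra all_fingroup.
From mathcomp Require Import all_solvable all_field all_character complex.
From mathcomp Require Import reals topology normedtype sequences exp.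
From mathcomp Require Import ring lra.
Import Order.TTheory GRing.Theory Num.Theory numFieldNormedType.Exports.
Local Open Scope ring_scope.
Set Implicit Arguments.
Unset Strict Implicit.
Unset Printing Implicit Defensive.

(** * Hyperbolic cosine and sampling without replacement *)

Section Cosh.
Variable R : realType.
Implicit Types (w x y z : R).

Definition cosh z : R := (expR z + expR (- z)) / 2.
Definition sinh z : R := (expR z - expR (- z)) / 2.

Lemma coshD x y : cosh (x + y) = cosh x * cosh y + sinh x * sinh y.
Proof. by rewrite /cosh /sinh opprD !expRD; field. Qed.

Lemma coshB x y : cosh (x - y) = cosh x * cosh y - sinh x * sinh y.
Proof. by rewrite /cosh /sinh opprB (addrC y) !expRD; field. Qed.

Lemma cosh_ge0 z : 0 <= cosh z.
Proof. by rewrite /cosh divr_ge0 ?addr_ge0 ?expR_ge0. Qed.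

Lemma sinh_ge0 z : 0 <= z -> 0 <= sinh z.
Proof. by move=> z0; rewrite /sinh divr_ge0 // subr_ge0 ler_expR; lra. Qed.

Lemma expR_le_cosh z : expR z <= 2 * cosh z.
Proof. by have := expR_ge0 (- z); rewrite /cosh; lra. Qed.

(** As an average of exponential coefficients, the series inherits its convergence from the
    exponential series. *)
Definition cosh_coeff z j : R := (exp_coeff z j + exp_coeff (- z) j) / 2.

Lemma cosh_coeffE z j :
  cosh_coeff z j = if odd j then 0 else (z ^+ 2) ^+ j./2 / j`!%:R.
Proof.
rewrite /cosh_coeff /exp_coeff /= exprNn -signr_odd -[in z ^+ j](odd_double_half j).
case: (odd j) => /=; first by rewrite expr1 mulN1r mulNr subrr mul0r.
by rewrite expr0 mul1r add0n -mul2n exprM; field; rewrite pnatr_eq0 -lt0n fact_gt0.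
Qed.

Local Open Scope classical_set_scope.

Lemma cvg_cosh z : series (cosh_coeff z) @ \oo --> cosh z.
Proof.
have -> : series (cosh_coeff z) =
    (fun n => (series (exp_coeff z) n + series (exp_coeff (- z)) n) / 2).
  apply/boolp.funext => n; rewrite /series /= -big_split /= mulr_suml.
  by apply: eq_bigr.
apply: cvgMl; apply: cvgD; exact: is_cvg_series_exp_coeff.
Qed.

(** In the induction step the gap is [w * (1 - w) * (x - y) * (x ^+ n - y ^+ n)], whose last two
    factors have the same sign. *)
Lemma convex_exprn w x y n : 0 <= w <= 1 -> 0 <= x -> 0 <= y ->
  (w * x + (1 - w) * y) ^+ n <= w * x ^+ n + (1 - w) * y ^+ n.
Proof.
move=> /andP[w0 w1] x0 y0; elim: n => [|n IH]; first by rewrite !expr0; lra.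
have xy : 0 <= (x - y) * (x ^+ n - y ^+ n).
  case: (lerP x y) => h.
    by rewrite mulr_le0 // subr_le0 // lerXn2r.
  by rewrite mulr_ge0 // subr_ge0 ?lerXn2r // ltW.
rewrite [leLHS]exprS.
apply: (@le_trans _ _ ((w * x + (1 - w) * y) * (w * x ^+ n + (1 - w) * y ^+ n))).
  by apply: ler_wpM2l => //; rewrite addr_ge0 // mulr_ge0 // subr_ge0.
rewrite !exprS; have := mulr_ge0 (mulr_ge0 w0 (_ : 0 <= 1 - w)) xy.
by rewrite subr_ge0 => /(_ w1); lra.
Qed.

(* [cosh] of a square root is convex: its power series in the square of the
   argument has nonnegative coefficients. *)
Lemma cosh_convex w x y z : 0 <= w <= 1 ->
  z ^+ 2 = w * x ^+ 2 + (1 - w) * y ^+ 2 ->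
  cosh z <= w * cosh x + (1 - w) * cosh y.
Proof.
move=> w01 zE.
have cR : (fun n => w * series (cosh_coeff x) n
    + (1 - w) * series (cosh_coeff y) n) @ \oo --> w * cosh x + (1 - w) * cosh y.
  by apply: cvgD; apply: cvgMr; exact: cvg_cosh.
apply: ler_cvg_to (@cvg_cosh z) cR _; apply: nearW => n.
rewrite /series /= !mulr_sumr -big_split; apply: ler_sum => j _ /=.
rewrite !cosh_coeffE; case: (odd j); first by rewrite !mulr0 addr0.
rewrite zE [w * (_ / _)]mulrA [(1 - w) * (_ / _)]mulrA -mulrDl.
apply: ler_wpM2r; first by rewrite invr_ge0.
by apply: convex_exprn; rewrite ?sqr_ge0.
Qed.

Lemma fact_double_ge n : (2 ^ n * n`! <= (n.*2)`!)%N.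
Proof.
elim: n => // n IH; rewrite doubleS !factS expnS.
have -> : (2 * 2 ^ n * (n.+1 * n`!) = n.*2.+2 * (2 ^ n * n`!))%N.
  by rewrite -doubleS -mul2n; ring.
by rewrite leq_mul2l /= (leq_trans IH) // leq_pmull.
Qed.

(** The series compare term by term: [z ^+ (2 * i) / (2 * i)!] is at most [(z ^+ 2 / 2) ^+ i / i!]
    by [fact_double_ge]. *)
Lemma cosh_le_expR z : cosh z <= expR (z ^+ 2 / 2).
Proof.
have z2 : 0 <= z ^+ 2 / 2 by rewrite divr_ge0 ?sqr_ge0.
(* Odd coefficients vanish, and there are [uphalf n] even indices below [n]. *)
have partial n : series (cosh_coeff z) n
    <= series (exp_coeff (z ^+ 2 / 2)) (uphalf n).
  elim: n => [|n IH]; first by rewrite /series /= !big_geq.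
  rewrite /series /= big_nat_recr //=.
  rewrite cosh_coeffE; move: IH; rewrite /series /= uphalf_half.
  case odd_n: (odd n) => /= IH; first by rewrite addr0; exact: IH.
  rewrite big_nat_recr //=; apply: lerD; first by [].
  rewrite /exp_coeff /= expr_div_n -mulrA; apply: ler_wpM2l.
    by rewrite exprn_ge0 ?sqr_ge0.
  have f0 p : 0 < p`!%:R :> R by rewrite ltr0n fact_gt0.
  rewrite -invfM lef_pV2 ?posrE ?mulr_gt0 ?exprn_gt0 // -natrX -natrM.
  by rewrite ler_nat -[in leqRHS](odd_double_half n) odd_n fact_double_ge.
apply: (cvgr_to_le (@cvg_cosh z)); apply: nearW => n.
apply: le_trans (partial n) _.
apply: nondecreasing_cvgn_le; last exact: is_cvg_series_exp_coeff.
by apply: nondecreasing_series => p _ _; exact: exp_coeff_ge0.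
Qed.

(* The value at [(a + c, b + d)] is at most the chord, in the cosine of the angle
   between [(a, b)] and [(c, d)], through the two collinear cases. *)
Lemma cosh_add_unit l a b : 0 <= l ->
  exists2 K, 0 <= K & forall c d, c ^+ 2 + d ^+ 2 = 1 ->
    cosh (l * Num.sqrt ((a + c) ^+ 2 + (b + d) ^+ 2)) <=
    cosh l * cosh (l * Num.sqrt (a ^+ 2 + b ^+ 2)) + K * (a * c + b * d).
Proof.
move=> l0; set r := Num.sqrt (a ^+ 2 + b ^+ 2).
have r0 : 0 <= r := sqrtr_ge0 _.
have r2 : r ^+ 2 = a ^+ 2 + b ^+ 2 by rewrite sqr_sqrtr // addr_ge0 ?sqr_ge0.
(* Slope of the chord between the collinear cases [p = r] and [p = - r]. If [r = 0], the quotient is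
   0 by convention, and [p = 0] by Cauchy-Schwarz. *)
exists (sinh l * sinh (l * r) / r) => [|c d cd].
  by rewrite divr_ge0 // mulr_ge0 // sinh_ge0 // mulr_ge0.
set p := a * c + b * d; pose q := p / r.
have p_r : p ^+ 2 <= r ^+ 2.
  rewrite r2 -[leRHS]mulr1 -cd -subr_ge0.
  suff -> : (a ^+ 2 + b ^+ 2) * (c ^+ 2 + d ^+ 2) - p ^+ 2
      = (a * d - b * c) ^+ 2 by rewrite sqr_ge0.
  by rewrite /p; ring.
have qr : q * r = p.
  rewrite /q; have [r00|r_neq0] := eqVneq r 0; last by rewrite divfK.
  rewrite r00 mulr0; apply/esym/eqP; rewrite -sqrf_eq0 eq_le sqr_ge0 andbT.
  by rewrite (le_trans p_r) // r00 expr0n.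
have q1 : -1 <= q <= 1.
  rewrite -ler_norml /q normrM normfV (ger0_norm r0).
  have [r00|r_neq0] := eqVneq r 0; first by rewrite r00 invr0 mulr0.
  rewrite ler_pdivrMr ?lt_def ?r_neq0 // mul1r -(ger0_norm r0).
  by rewrite -ler_sqr ?nnegrE // !real_normK ?num_real.
have w01 : 0 <= (1 + q) / 2 <= 1 by move: q1; lra.
(* With weight [(1 + q) / 2], the squares of [r + 1] and [r - 1] average to
   [r ^+ 2 + 1 + 2 * q * r], the squared length of the new sum. *)
apply: le_trans (cosh_convex (x := l * r + l) (y := l * r - l) w01 _) _.
  rewrite exprMn sqr_sqrtr ?addr_ge0 ?sqr_ge0 //.
  transitivity (l ^+ 2 * (r ^+ 2 + (c ^+ 2 + d ^+ 2) + 2 * (q * r))).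
    by rewrite qr r2 /p; ring.
  rewrite cd.
  by field.
rewrite coshD coshB -qr le_eqVlt; apply/orP; left; apply/eqP.
have sr : sinh (l * r) / r * r = sinh (l * r).
  have [->|r_neq0] := eqVneq r 0; last by rewrite divfK.
  by rewrite !mulr0 /sinh oppr0 subrr mul0r.
transitivity (cosh l * cosh (l * r) + q * sinh l * (sinh (l * r) / r * r)).
  by rewrite sr; field.
by ring.
Qed.

End Cosh.

(** * Tail bound for random subsets of fixed size *)

Section Sampling.
Variables (T : finType).

(** Double counting: a set of size [j.+1] arises from [j.+1] choices of the element drawn last. *)
Lemma sum_subsets_setU1 (V : nmodType) j (f : {set T} -> V) :
  \sum_(A : {set T} | #|A| == j) \sum_(g | g \notin A) f (g |: A) =
  (\sum_(A : {set T} | #|A| == j.+1) f A) *+ j.+1.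
Proof.
rewrite -sumrMnl [RHS](eq_bigr (fun A : {set T} => \sum_(g in A) f A)); last first.
  by move=> A /eqP <-; rewrite sumr_const.
rewrite (exchange_big_dep predT) //= [RHS](exchange_big_dep predT) //=.
apply: eq_bigr => g _.
rewrite [RHS](reindex_onto (fun A => g |: A) (fun A => A :\ g)) /=; last first.
  by move=> A /andP[_ gA]; rewrite setD1K.
apply: eq_bigl => A; rewrite setU11 andbT cardsU1.
case: (boolP (g \in A)) => gA /=.
  rewrite andbF; apply/esym/negP => /andP[_ /eqP/setP/(_ g)].
  by rewrite !inE eqxx gA.
by rewrite setU1K // eqxx !andbT.
Qed.

Variables (R : realType) (x y : T -> R).
Hypothesis xy1 : forall g, x g ^+ 2 + y g ^+ 2 = 1.
Hypotheses (sumx : \sum_g x g = 0) (sumy : \sum_g y g = 0).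

Definition sqnorm_sum (A : {set T}) : R :=
  (\sum_(g in A) x g) ^+ 2 + (\sum_(g in A) y g) ^+ 2.

(* Pinelis' argument. Without replacement the remaining elements have mean
   opposite to the current sum, which only helps. *)
Lemma sum_cosh_le l j : 0 <= l ->
  \sum_(A : {set T} | #|A| == j) cosh (l * Num.sqrt (sqnorm_sum A))
  <= 'C(#|T|, j)%:R * cosh l ^+ j.
Proof.
move=> l0; elim: j => [|j IH].
  rewrite (big_pred1 set0) => [|A]; last by rewrite cards_eq0.
  rewrite /sqnorm_sum !big_set0 expr0n addr0 sqrtr0 mulr0 bin0 mulr1.
  by rewrite /cosh oppr0 expR0 -[1 + 1]/(2%:R) divff ?pnatr_eq0.
rewrite -(ler_pM2l (ltr0Sn R j)) mulr_natl -sum_subsets_setU1.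
apply: (@le_trans _ _ (\sum_(A : {set T} | #|A| == j)
   ((#|T| - j)%:R * (cosh l * cosh (l * Num.sqrt (sqnorm_sum A)))))).
  apply: ler_sum => A /eqP cA.
  have [K K0 hK] := cosh_add_unit (\sum_(g in A) x g) (\sum_(g in A) y g) l0.
  have compl (z : T -> R) : \sum_g z g = 0 ->
      \sum_(g | g \notin A) z g = - \sum_(g in A) z g.
    by rewrite (bigID (mem A)) /= addrC => /addr0_eq <-; rewrite opprK.
  apply: (@le_trans _ _ (\sum_(g | g \notin A)
    (cosh l * cosh (l * Num.sqrt (sqnorm_sum A)) +
     K * ((\sum_(h in A) x h) * x g + (\sum_(h in A) y h) * y g)))).
    apply: ler_sum => g gA; apply: le_trans (hK _ _ (xy1 g)).
    by rewrite /sqnorm_sum !big_setU1 //= ![x g + _]addrC ![y g + _]addrC.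
  rewrite big_split /= sumr_const -mulr_sumr big_split /= -!mulr_sumr !compl //.
  have -> : #|[pred g | g \notin A]| = (#|T| - j)%N.
    by rewrite -cA -(cardC (mem A)) addKn; apply: eq_card => g; rewrite !inE.
  rewrite [leRHS]mulr_natl gerDl mulr_ge0_le0 // !mulrN -!expr2 -opprD oppr_le0.
  by rewrite addr_ge0 ?sqr_ge0.
rewrite -!mulr_sumr.
apply: le_trans (ler_wpM2l (ler0n _ _) (ler_wpM2l (cosh_ge0 l) IH)) _.
(* The number of ways to draw one more element turns ['C(#|T|, j)] into [j.+1 * 'C(#|T|, j.+1)]. *)
rewrite [leRHS]mulrA -natrM mul_bin_left natrM exprS le_eqVlt.
by apply/orP; left; apply/eqP; ring.
Qed.

(** Markov's inequality for the mean of [cosh]. The factor 2 comes from bounding [cosh] below by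
    half an exponential. *)
Lemma sampling_tail m t : (0 < m)%N -> 0 <= t ->
  #|[set A : {set T} | (#|A| == m) && (t ^+ 2 < sqnorm_sum A)]|%:R
  <= 2 * expR (- (t ^+ 2 / (2 * m%:R))) * 'C(#|T|, m)%:R.
Proof.
move=> m0 t0; have mR : 0 < m%:R :> R by rewrite ltr0n.
(* This value minimizes the exponent [m * l ^+ 2 / 2 - l * t]. *)
pose l := t / m%:R; have l0 : 0 <= l by rewrite divr_ge0 // ltW.
set B := [set _ | _].
have : #|B|%:R * (expR (l * t) / 2) <=
    'C(#|T|, m)%:R * expR (m%:R * (l ^+ 2 / 2)).
  apply: le_trans (le_trans (sum_cosh_le m l0) _); last first.
    rewrite ler_wpM2l // expRM_natl lerXn2r ?nnegrE ?cosh_ge0 ?expR_ge0 //.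
    exact: cosh_le_expR.
  rewrite mulr_natl -sumr_const [leRHS](bigID (mem B)) /= -[leLHS]addr0.
  apply: lerD; last by apply: sumr_ge0 => A _; exact: cosh_ge0.
  rewrite [leRHS](eq_bigl (mem B)) => [|A]; last first.
    by rewrite !inE; case: (#|A| == m).
  apply: ler_sum => A; rewrite inE => /andP[_ tA].
  rewrite ler_pdivrMr // [leRHS]mulrC; apply: le_trans (expR_le_cosh _).
  rewrite ler_expR ler_wpM2l // -[leLHS]ger0_norm // -sqrtr_sqr ler_wsqrtr //.
  exact: ltW.
set q := t ^+ 2 / _.
have -> : l * t = q + q by rewrite /l /q; field; rewrite gt_eqF.
have -> : m%:R * (l ^+ 2 / 2) = q by rewrite /l /q; field; rewrite gt_eqF.
have q0 := expR_gt0 q; rewrite expRD expRN => h.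
rewrite -(ler_pM2r (_ : 0 < expR q * expR q / 2)); last first.
  by rewrite divr_gt0 ?mulr_gt0.
apply: le_trans h _; rewrite le_eqVlt; apply/orP; left; apply/eqP.
by field; rewrite gt_eqF.
Qed.

End Sampling.

(** * Characters of a finite abelian group *)

(** In characteristic zero ['X^n - 1] is separable, so it has [n] distinct roots, and [n] distinct
    roots of unity of exponent [n] include a primitive one. *)
Lemma ex_primitive_root (F : numClosedFieldType) n :
  (0 < n)%N -> exists z : F, n.-primitive_root z.
Proof.
move=> n0; have [r rE] := closed_field_poly_normal ('X^n - 1 : {poly F}).
rewrite (monicP (monicXnsubC _ n0)) scale1r in rE.
have sz_r : (size r).+1 = n.+1 by rewrite -(size_prod_XsubC r id) -rE size_XnsubC.
suff /hasP[z _ prim_z] : has n.-primitive_root r by exists z.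
apply: has_prim_root => //; last by rewrite -ltnS sz_r.
  by apply/allP => z; rewrite -root_prod_XsubC -rE.
by rewrite -separable_prod_XsubC -rE separable_Xn_sub_1 // pnatr_eq0 -lt0n.
Qed.

(** The map sends [z ^+ i] to [w ^+ i], which is well defined and injective because both roots have
    order [m]; elsewhere it takes the default value 0. *)
Lemma unity_roots_embedding (K : fieldType) (z : K) m (F' : fieldType) (w : F') :
  m.-primitive_root z -> m.-primitive_root w ->
  exists s : K -> F', [/\ s 1 = 1,
    forall x y, x ^+ m = 1 -> y ^+ m = 1 -> s (x * y) = s x * s y,
    forall x, x ^+ m = 1 -> s x ^+ m = 1 &
    forall x y, x ^+ m = 1 -> y ^+ m = 1 -> s x = s y -> x = y].
Proof.
move=> prim_z prim_w.
pose s x := if [pick i : 'I_m | x == z ^+ i] is Some i then w ^+ i else 0.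
have sE i : s (z ^+ i) = w ^+ i.
  rewrite /s; case: pickP => [j /eqP/esym/eqP|].
    by rewrite (eq_prim_root_expr prim_z) => e; apply/eqP;
       rewrite (eq_prim_root_expr prim_w).
  have m0 := prim_order_gt0 prim_z.
  move/(_ (Ordinal (ltn_pmod i m0))); rewrite (eq_prim_root_expr prim_z) /=.
  by rewrite modn_mod eqxx.
exists s; split.
- by rewrite -(expr0 z) sE.
- move=> x y /(prim_rootP prim_z)[i ->] /(prim_rootP prim_z)[j ->].
  by rewrite -exprD !sE exprD.
- move=> x /(prim_rootP prim_z)[i ->].
  by rewrite sE exprAC (prim_expr_order prim_w) expr1n.
move=> x y /(prim_rootP prim_z)[i ->] /(prim_rootP prim_z)[j ->].
rewrite !sE => /eqP; rewrite (eq_prim_root_expr prim_w) => e; apply/eqP.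
by rewrite (eq_prim_root_expr prim_z).
Qed.

Section Characters.
Variables (F : numClosedFieldType) (G : finZmodType).
Local Notation n := #|G|.
Local Notation gG := [set: G]%G.

Lemma sum_nontrivial_char (chi : G -> F) a :
  (forall g h, chi (g + h) = chi g * chi h) -> chi a != 1 -> \sum_g chi g = 0.
Proof.
move=> chiD a1; apply/eqP; have : chi a * \sum_g chi g = \sum_g chi g.
  rewrite mulr_sumr [RHS](reindex_inj (addrI a)) /=.
  by apply: eq_bigr => g _; rewrite chiD.
move/eqP; rewrite -subr_eq0 -{2}[\sum_g _]mul1r -mulrBl mulf_eq0 subr_eq0.
by rewrite (negPf a1).
Qed.

(* The characters are those of the [algC] theory, transported through a bijection
   between the roots of unity of [algC] and of [F]. *)
Lemma ex_dual_group : exists (I : finType) (i0 : I) (chi : I -> G -> F),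
  [/\ #|I| = n, forall i g h, chi i (g + h) = chi i g * chi i h,
      forall i g, `|chi i g| = 1 & forall g, chi i0 g = 1] /\
  ((forall i, i != i0 -> \sum_g chi i g = 0) /\
   forall g, \sum_i chi i g = (n * (g == 0))%:R).
Proof.
have n0 : (0 < n)%N by apply/card_gt0P; exists 0.
have [z prim_z] := ex_primitive_root algC n0.
have [w prim_w] := ex_primitive_root F n0.
have [s [s1 sM sX s_inj]] := unity_roots_embedding prim_z prim_w.
have lin i : 'chi[gG]_i \is a linear_char.
  by apply/char_abelianP/FinRing.zmod_abelian.
have ord i (g : G) : 'chi[gG]_i g ^+ n = 1.
  have /dvdnP[q nE] : (#[g]%g %| n)%N by rewrite -cardsT order_dvdG ?inE.
  by rewrite [in LHS]nE mulnC exprM (lin_char_unity_root (lin i)) ?inE ?expr1n.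
pose chi (i : Iirr gG) (g : G) := s ('chi_i g).
have chiD i g h : chi i (g + h) = chi i g * chi i h.
  by rewrite /chi -FinRing.zmodMgE (lin_charM (lin i)) ?inE // sM.
have chi_norm i g : `|chi i g| = 1.
  apply/eqP; rewrite -(@pexpr_eq1 _ _ n) // ?normr_ge0 // -normrX.
  by rewrite sX ?normr1.
have chi0 g : chi 0 g = 1 by rewrite /chi irr0 cfun1E inE.
have cardI : #|Iirr gG| = n.
  rewrite card_ord NirrE -cardsT; apply/eqP.
  by rewrite -card_classes_abelian FinRing.zmod_abelian.
have chi_neq i j : i != j -> exists a, chi i a != chi j a.
  move=> ij; apply/existsP; rewrite -negb_forall; apply: contra ij => /forallP e.
  by apply/eqP/irr_inj/cfunP => g; apply: s_inj => //; apply/eqP/e.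
have orth i j : \sum_g chi i g * (chi j g)^-1 = (n * (i == j))%:R.
  have chi_neq0 g : chi j g != 0 by rewrite -normr_eq0 chi_norm oner_eq0.
  case: eqVneq => [->|ij]; last first.
    rewrite muln0 mulr0n; have [a ija] := chi_neq _ _ ij.
    apply: (@sum_nontrivial_char _ a) => [g h|].
      by rewrite !chiD invfM mulrACA.
    by apply: contra ija => /eqP e;
      rewrite -(divfK (chi_neq0 a) (chi i a)) e mul1r.
  rewrite muln1 (eq_bigr (fun=> 1)) => [|g _]; last by rewrite divff.
  by rewrite sumr_const.
exists (Iirr gG), 0, chi; split=> //; split=> [i i0|g].
  transitivity (\sum_g chi i g * (chi 0 g)^-1).
    by apply: eq_bigr => g _; rewrite chi0 invr1 mulr1.
  by rewrite orth (negPf i0) muln0.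
have [->|g0] := eqVneq g 0.
  rewrite muln1 (eq_bigr (fun=> 1)) => [|i _]; last first.
    by rewrite /chi (lin_char1 (lin i)).
  by rewrite sumr_const cardI.
(* The irreducible characters have trivial common kernel, so some character separates [g] from 0. *)
rewrite muln0 mulr0n; have [a chi_a] : exists a, chi a g != 1.
  apply/existsP; rewrite -negb_forall; apply: contra g0 => /forallP e.
  have : g \in (\bigcap_i cfker 'chi[gG]_i)%g.
    apply/bigcapP => i _; rewrite cfkerEirr !inE (lin_char1 (lin i)) /=.
    by apply/eqP/s_inj; rewrite ?expr1n // s1; apply/eqP/e.
  by rewrite TI_cfker_irr => /set1P ->.
(* Multiplication by the linear character [a] permutes the characters, so the sum is invariant under
   multiplication by [chi a g], which is not 1. *)
pose h i := cfIirr ('chi[gG]_a * 'chi_i).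
have hE i : 'chi_(h i) = 'chi_a * 'chi_i.
  by rewrite cfIirrE // mul_lin_irr ?mem_irr.
have h_inj : injective h.
  move=> i j e; apply/irr_inj/(mulrI (lin_char_unitr (lin a))).
  by rewrite -!hE e.
apply/eqP; have : chi a g * \sum_i chi i g = \sum_i chi i g.
  rewrite mulr_sumr [RHS](reindex_inj h_inj) /=.
  by apply: eq_bigr => i _; rewrite /chi hE cfunE sM.
move/eqP; rewrite -subr_eq0 -{2}[\sum_i _]mul1r -mulrBl mulf_eq0 subr_eq0.
by rewrite (negPf chi_a).
Qed.
End Characters.

(** * Fourier bound for the form with matrix [1_A(u + v + s)] *)

Section Fourier.
Variables (F : numClosedFieldType) (G : finZmodType).
Variables (I : finType) (i0 : I) (chi : I -> G -> F).
Hypotheses (chiD : forall i g h, chi i (g + h) = chi i g * chi i h)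
  (chi_norm : forall i g, `|chi i g| = 1) (chi0 : forall g, chi i0 g = 1)
  (chi_orth : forall g, \sum_i chi i g = (#|G| * (g == 0))%:R).

Lemma char_opp i g : chi i (- g) = (chi i g)^*.
Proof.
have nz h : chi i h != 0 by rewrite -normr_eq0 chi_norm oner_eq0.
apply: (mulfI (nz g)); rewrite -normCK chi_norm -chiD subrr expr1n.
by apply: (mulfI (nz 0)); rewrite -chiD addr0 mulr1.
Qed.

Lemma parseval (f : G -> F) :
  \sum_i `|\sum_g f g * chi i g| ^+ 2 = #|G|%:R * \sum_g `|f g| ^+ 2.
Proof.
transitivity (\sum_u \sum_v f u * (f v)^* * \sum_i chi i (u - v)).
  under eq_bigr => i _.
    rewrite normCK rmorph_sum mulr_suml; under eq_bigr do rewrite mulr_sumr.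
    over.
  rewrite exchange_big; apply: eq_bigr => u _; rewrite exchange_big.
  apply: eq_bigr => v _; rewrite mulr_sumr; apply: eq_bigr => i _.
  by rewrite chiD char_opp rmorphM /=; ring.
rewrite mulr_sumr; apply: eq_bigr => u _.
rewrite (bigD1 u) //= [X in _ + X]big1 ?addr0 => [|v vu].
  by rewrite chi_orth subrr eqxx muln1 normCK mulrC.
by rewrite chi_orth subr_eq0 eq_sym (negPf vu) muln0 mulr0.
Qed.

Variables (A : {set G}) (lam : F).
Hypotheses (lam0 : 0 <= lam)
  (lamP : forall i, i != i0 -> `|\sum_(a in A) chi i a| <= lam).

(* The matrix [1_A(u + v + s)] is diagonalized by the characters, up to
   conjugating them; the trivial one contributes the first term. *)
Lemma sum_graph_form_le (f : G -> F) s :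
  \sum_v \sum_u f v * (f u)^* * (u + v + s \in A)%:R
  <= #|A|%:R / #|G|%:R * `|\sum_g f g| ^+ 2 + lam * \sum_g `|f g| ^+ 2.
Proof.
have n0 : 0 < #|G|%:R :> F by rewrite ltr0n; apply/card_gt0P; exists 0.
set T := \sum_v _.
(* The matrix is real and symmetric. Being real, the nontrivial part can later be bounded by its
   norm. *)
have T_real : T \is Num.real.
  apply/CrealP; rewrite /T rmorph_sum; under eq_bigr do rewrite rmorph_sum.
  rewrite exchange_big; apply: eq_bigr => u _; apply: eq_bigr => v _.
  by rewrite !rmorphM /= conjCK rmorph_nat (addrC u) [_^* * _]mulrC.
pose P i := \sum_g f g * chi i g; pose Q i := \sum_g (f g)^* * chi i g.
pose c i := chi i s * (\sum_(a in A) chi i a)^* * P i * Q i.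
(* The indicator is a sum over [a] in [A] of point masses, each expanded into characters by
   [chi_orth]. *)
have TE : #|G|%:R * T = \sum_i c i.
  transitivity (\sum_v \sum_u \sum_(a in A) \sum_i
      f v * (f u)^* * chi i (u + v + s - a)).
    rewrite /T mulr_sumr; apply: eq_bigr => v _; rewrite mulr_sumr.
    apply: eq_bigr => u _; rewrite mulrCA.
    under [RHS]eq_bigr do rewrite -mulr_sumr.
    rewrite -mulr_sumr; congr (_ * _).
    under eq_bigr => a _ do rewrite chi_orth subr_eq0 natrM.
    rewrite -mulr_sumr; congr (_ * _).
    have [sA|sA] := boolP (u + v + s \in A).
      rewrite (bigD1 (u + v + s)) //= eqxx big1 ?addr0 // => a /andP[_ /negPf].
      by rewrite eq_sym => ->.
    by rewrite big1 // => a aA; case: eqP sA => // ->; rewrite aA.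
  under eq_bigr => v _ do under eq_bigr => u _ do rewrite exchange_big /=.
  under eq_bigr => v _ do rewrite exchange_big /=.
  rewrite exchange_big /=; apply: eq_bigr => i _.
  rewrite /c [_ * P i]mulr_sumr mulr_suml; apply: eq_bigr => v _.
  rewrite /Q mulr_sumr; apply: eq_bigr => u _.
  rewrite rmorph_sum mulr_sumr !mulr_suml.
  by apply: eq_bigr => a _; rewrite !chiD char_opp /=; ring.
have E0 : c i0 = #|A|%:R * `|\sum_g f g| ^+ 2.
  rewrite /c chi0 mul1r (eq_bigr (fun=> 1)) => [|a _]; last by rewrite chi0.
  rewrite sumr_const rmorph_nat -mulrA normCK; congr (_ * (_ * _)).
    by apply: eq_bigr => g _; rewrite chi0 mulr1.
  by rewrite rmorph_sum; apply: eq_bigr => g _; rewrite chi0 mulr1.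
have QE : \sum_i `|Q i| ^+ 2 = #|G|%:R * \sum_g `|f g| ^+ 2.
  by rewrite parseval; under eq_bigr do rewrite norm_conjC.
have bound : `|\sum_(i | i != i0) c i| <= #|G|%:R * (lam * \sum_g `|f g| ^+ 2).
  apply: le_trans (ler_norm_sum _ _ _) _.
  (* The arithmetic-geometric mean inequality separates [P] from [Q], and Parseval then applies to
     each. *)
  apply: (@le_trans _ _ (\sum_i lam / 2 * (`|P i| ^+ 2 + `|Q i| ^+ 2))); last first.
    rewrite -mulr_sumr big_split /= parseval QE le_eqVlt; apply/orP; left.
    by apply/eqP; field.
  have term_ge0 i : 0 <= lam / 2 * (`|P i| ^+ 2 + `|Q i| ^+ 2).
    by rewrite mulr_ge0 ?divr_ge0 ?addr_ge0 ?exprn_ge0.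
  rewrite [leRHS](bigID (fun i => i != i0)) /= ler_wpDr ?sumr_ge0 //.
  apply: ler_sum => i ii0; rewrite /c !normrM chi_norm mul1r norm_conjC -!mulrA.
  apply: le_trans (ler_wpM2r _ (lamP ii0)) _; first by rewrite mulr_ge0.
  apply: ler_wpM2l => //; rewrite ler_pdivlMl // -subr_ge0.
  have -> : `|P i| ^+ 2 + `|Q i| ^+ 2 - 2 * (`|P i| * `|Q i|)
    = (`|P i| - `|Q i|) ^+ 2 by ring.
  by rewrite real_exprn_even_ge0 // rpredB ?normr_real.
rewrite -(ler_pM2l n0) mulrDr TE (bigD1 i0) //= E0.
have -> : #|G|%:R * (#|A|%:R / #|G|%:R * `|\sum_g f g| ^+ 2)
  = #|A|%:R * `|\sum_g f g| ^+ 2 by field; rewrite gt_eqF.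
rewrite lerD2l; apply: le_trans bound; apply: real_ler_norm.
have -> : \sum_(i | i != i0) c i = #|G|%:R * T - #|A|%:R * `|\sum_g f g| ^+ 2.
  by rewrite TE [X in X - _](bigD1 i0) //= E0 addrAC subrr add0r.
by rewrite rpredB ?rpredM ?rpredX ?normr_real ?realn.
Qed.

End Fourier.

(** * Laplacians of sum complexes *)

Section Tuples.
Variable V : finType.
Implicit Types (v : V) (p : nat).

(** Inverse to splitting a tuple into its entry [i] and [face i]. Repetitions are allowed, so that
    entry and face can be summed independently. *)
Definition ins p (i : 'I_p.+1) v (z : {ffun 'I_p -> V}) : {ffun 'I_p.+1 -> V} :=
  [ffun l => oapp z v (unlift i l)].

Definition face p (i : 'I_p.+1) (t : {ffun 'I_p.+1 -> V}) : {ffun 'I_p -> V} :=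
  [ffun l => t (lift i l)].

Lemma ins_id p i v (z : {ffun 'I_p -> V}) : ins i v z i = v.
Proof. by rewrite ffunE unlift_none. Qed.

Lemma ins_lift p i v (z : {ffun 'I_p -> V}) l : ins i v z (lift i l) = z l.
Proof. by rewrite ffunE liftK. Qed.

Lemma face_ins p i v (z : {ffun 'I_p -> V}) : face i (ins i v z) = z.
Proof. by apply/ffunP => l; rewrite ffunE ins_lift. Qed.

Lemma ins_face p i (t : {ffun 'I_p.+1 -> V}) : ins i (t i) (face i t) = t.
Proof.
apply/ffunP => l; case: (unliftP i l) => [l' ->|->]; last by rewrite ins_id.
by rewrite ins_lift ffunE.
Qed.

Lemma face_lift0_ins p (i : 'I_p.+1) v (z : {ffun 'I_p.+1 -> V}) :
  face (lift ord0 i) (ins ord0 v z) = ins ord0 v (face i z).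
Proof.
apply/ffunP => l; rewrite ffunE; case: (unliftP ord0 l) => [l' ->|->].
  have -> : lift (lift ord0 i) (lift ord0 l') = lift ord0 (lift i l').
    by apply/val_inj => /=; rewrite bumpS.
  by rewrite !ins_lift ffunE.
have -> : lift (lift ord0 i) ord0 = ord0 by apply/val_inj; rewrite /= /bump.
by rewrite !ins_id.
Qed.

Lemma sum_ins (W : nmodType) p (i : 'I_p.+1) (f : {ffun 'I_p.+1 -> V} -> W) :
  \sum_t f t = \sum_v \sum_z f (ins i v z).
Proof.
rewrite pair_bigA (reindex (fun q => ins i q.1 q.2)) //=.
exists (fun t : {ffun 'I_p.+1 -> V} => (t i, face i t)) => [[v z]|t] _ /=.
  by rewrite ins_id face_ins.
exact: ins_face.
Qed.

End Tuples.

(** * Cochains extended by zero to all tuples *)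

Section Extension.
Variables (R : realType) (V : finType) (X : simplicial_complex V).
Local Notation tup p := {ffun 'I_p -> V}.
Local Notation cochain := (@cochain R V X).

Definition ext p (phi : cochain p) (t : tup p) : R[i] :=
  oapp (ev phi) 0 (insub t).

Lemma ext_val p (phi : cochain p) (t : osimplex X p) : ext phi (val t) = ev phi t.
Proof. by rewrite /ext valK. Qed.

Lemma ext_out p (phi : cochain p) (t : tup p) : ~~ is_osimplex X t -> ext phi t = 0.
Proof. by move=> tX; rewrite /ext insubN. Qed.

Lemma ext_reorder p (phi : cochain p) (s : 'S_p) (t : tup p) :
  ext phi [ffun i => t (s i)] = (-1) ^+ s * ext phi t.
Proof.
have [tX|tX] := boolP (is_osimplex X t).
  pose u : osimplex X p := Sub t tX.
  by rewrite -[t]/(val u) -[[ffun _ => _]]/(val (reorder s u)) !ext_val evP.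
rewrite (ext_out _ tX) mulr0 ext_out //; apply: contra tX => sX.
pose u : osimplex X p := Sub _ sX.
have -> : t = val (reorder s^-1%g u); last exact: valP.
by apply/ffunP => i; rewrite !ffunE permKV.
Qed.

(** Moving entry [i] to the front is a cycle of sign [(-1) ^+ i]. *)
Lemma ext_ins p (phi : cochain p.+1) i v (z : tup p) :
  ext phi (ins i v z) = (-1) ^+ i * ext phi (ins ord0 v z).
Proof.
have -> : ins i v z = [ffun l => ins ord0 v z (lift_perm i ord0 1%g l)].
  apply/ffunP => l; rewrite [RHS]ffunE; case: (unliftP i l) => [l' ->|->].
    by rewrite lift_perm_lift perm1 !ins_lift.
  by rewrite lift_perm_id !ins_id.
by rewrite ext_reorder odd_lift_perm /= odd_perm1 !addbF signr_odd.
Qed.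

Lemma is_osimplex_face p i (t : tup p.+1) :
  is_osimplex X t -> is_osimplex X (face i t).
Proof. by move=> tX; exact: (valP (del i (Sub t tX : osimplex X p.+1))). Qed.

Lemma cdot_ext p (phi psi : cochain p) :
  p`!%:R * cdot phi psi = \sum_t ext phi t * (ext psi t)^*.
Proof.
rewrite cdotE mulVKf ?pnatr_eq0 -?lt0n ?fact_gt0 //.
rewrite [RHS](bigID (fun t => is_osimplex X t)) /= [X in _ + X]big1 ?addr0.
  rewrite (big_sub (@is_osimplex V X p) (fun t => ext phi t * (ext psi t)^*)).
  by apply: eq_bigr => t _; rewrite !ext_val.
by move=> t tX; rewrite ext_out // mul0r.
Qed.

Lemma ext_coboundary p (phi : cochain p) t : is_osimplex X t ->
  ext (coboundary R X p phi) t = \sum_(i < p.+1) (-1) ^+ i * ext phi (face i t).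
Proof.
move=> tX; pose u : osimplex X p.+1 := Sub t tX.
rewrite -[t]/(val u) ext_val /coboundary lfunE /ev /= ffunE.
by apply: eq_bigr => i _; rewrite -[face _ _]/(val (del i u)) ext_val.
Qed.

Lemma cdotC p (phi psi : cochain p) : cdot phi psi = (cdot psi phi)^*.
Proof.
rewrite !cdotE rmorphM fmorphV rmorph_nat rmorph_sum; congr (_ * _).
by apply: eq_bigr => t _; rewrite rmorphM /= conjCK mulrC.
Qed.

(** The explicit formula for the adjoint of the coboundary. *)
Definition link_sum p (phi : cochain p.+1) (z : tup p) : R[i] :=
  \sum_v ext phi (ins ord0 v z).

(** By skew-symmetry each of the [p.+1] positions of the deleted vertex contributes the same amount,
    which accounts for the ratio of the two factorials. *)
Lemma cdot_coboundary p (phi : cochain p) (psi : cochain p.+1) :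
  p`!%:R * cdot (coboundary R X p phi) psi =
  \sum_z ext phi z * (link_sum psi z)^*.
Proof.
have p0 : p.+1%:R != 0 :> R[i] by rewrite pnatr_eq0.
apply: (mulfI p0); rewrite mulrA -natrM -factS cdot_ext.
transitivity (\sum_(i < p.+1) \sum_t
    (-1) ^+ i * ext phi (face i t) * (ext psi t)^*).
  rewrite exchange_big; apply: eq_bigr => t _; rewrite -mulr_suml.
  have [tX|tX] := boolP (is_osimplex X t); first by rewrite ext_coboundary.
  by rewrite !(ext_out _ tX) mul0r rmorph0 mulr0.
rewrite (eq_bigr (fun=> \sum_z ext phi z * (link_sum psi z)^*)) => [|i _].
  by rewrite sumr_const card_ord mulr_natl.
rewrite (sum_ins i) exchange_big; apply: eq_bigr => z _ /=.
rewrite rmorph_sum mulr_sumr; apply: eq_bigr => v _ /=.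
rewrite face_ins ext_ins rmorphM rmorph_sign /= mulrACA mulrA.
by rewrite -expr2 sqrr_sign mul1r.
Qed.

Lemma link_sum_out p (phi : cochain p.+1) z :
  ~~ is_osimplex X z -> link_sum phi z = 0.
Proof.
move=> zX; rewrite /link_sum big1 // => v _; rewrite ext_out //.
by apply: contra zX => /(is_osimplex_face ord0); rewrite face_ins.
Qed.

Lemma link_sum_reorder p (phi : cochain p.+1) (s : 'S_p) (z : tup p) :
  link_sum phi [ffun i => z (s i)] = (-1) ^+ s * link_sum phi z.
Proof.
rewrite /link_sum mulr_sumr; apply: eq_bigr => v _.
have -> : ins ord0 v [ffun i => z (s i)] =
    [ffun l => ins ord0 v z (lift_perm ord0 ord0 s l)].
  apply/ffunP => l; rewrite [RHS]ffunE; case: (unliftP ord0 l) => [l' ->|->].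
    by rewrite lift_perm_lift !ins_lift ffunE.
  by rewrite lift_perm_id !ins_id.
by rewrite ext_reorder odd_lift_perm /=.
Qed.

Fact link_sum_skew p (phi : cochain p.+1) :
  [ffun t : osimplex X p => link_sum phi (val t) : R[i]^o] \in skew_space R X p.
Proof. by apply/skew_spaceP => s t; rewrite !ffunE link_sum_reorder. Qed.

Definition link_sum_cochain p (phi : cochain p.+1) : cochain p :=
  Subvs (link_sum_skew phi).

Lemma ext_link_sum p (phi : cochain p.+1) z :
  ext (link_sum_cochain phi) z = link_sum phi z.
Proof.
have [zX|zX] := boolP (is_osimplex X z); last by rewrite ext_out // link_sum_out.
pose u : osimplex X p := Sub z zX.
by rewrite -[z]/(val u) ext_val /ev /= ffunE.
Qed.

(** [adjoint] is known only through its defining identity, which is therefore tested against [eta]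
    itself and against the cochain given by [link_sum]. *)
Lemma cdot_adjoint_coboundary p (phi : cochain p.+1) :
  let eta := adjoint (coboundary R X p) phi in
  p`!%:R * cdot eta eta = \sum_z `|link_sum phi z| ^+ 2.
Proof.
move=> eta; pose pi := link_sum_cochain phi.
have adj th : \sum_z ext th z * (ext eta z)^* =
    \sum_z ext th z * (link_sum phi z)^*.
  by rewrite -cdot_ext -adjointP cdot_coboundary.
have sum_pi : \sum_z link_sum phi z * (ext eta z)^* =
    \sum_z `|link_sum phi z| ^+ 2.
  have := adj pi; under eq_bigr do rewrite ext_link_sum; move=> ->.
  by apply: eq_bigr => z _; rewrite ext_link_sum normCK.
rewrite cdot_ext adj -[RHS]conj_Creal; last first.
  by apply: rpred_sum => z _; rewrite rpredX ?normr_real.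
rewrite -sum_pi rmorph_sum; apply: eq_bigr => z _.
by rewrite rmorphM /= conjCK mulrC.
Qed.

End Extension.

(** * The quadratic form of the Laplacian of a sum complex *)

Section SumComplex.
Variables (R : realType) (G : finZmodType) (A : {set G}) (j : nat).
Local Notation k := j.+1.
Local Notation X := (sum_complex A k).
Local Notation tup p := {ffun 'I_p -> G}.

Lemma is_osimplex_small p (t : tup p) : (p <= k)%N ->
  is_osimplex X t = injectiveb t.
Proof.
move=> pk; rewrite /is_osimplex; case: injectiveP => //= t_inj.
by rewrite inE card_imset // card_ord pk.
Qed.

Lemma is_osimplex_top (t : tup k.+1) :
  is_osimplex X t = injectiveb t && (\sum_i t i \in A).
Proof.
rewrite /is_osimplex; case: injectiveP => //= t_inj.
rewrite inE card_imset // card_ord ltnn eqxx /=.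
by rewrite big_imset //= => x y _ _ /t_inj.
Qed.

Lemma sum_ffun_ins p (i : 'I_p.+1) v (z : tup p) :
  \sum_l ins i v z l = v + \sum_l z l.
Proof.
rewrite (bigD1_ord i) //= ins_id; congr (_ + _).
by apply: eq_bigr => l _; rewrite ins_lift.
Qed.

(** The case to check is [u] equal to an entry [z l] with the sum in [A]: the left side is 0, and on
    the right only the term [i = l] survives and cancels [ext phi z]. *)
Lemma ext_coboundary_ins (phi : cochain R X k) u (z : tup k) : injective z ->
  ext (coboundary R X k phi) (ins ord0 u z) =
  (u + \sum_l z l \in A)%:R *
    (ext phi z - \sum_(i < k) (-1) ^+ i * ext phi (ins ord0 u (face i z))).
Proof.
move=> z_inj; have [uzX|] := boolP (is_osimplex X (ins ord0 u z)).
  rewrite ext_coboundary //; move: uzX; rewrite is_osimplex_top => /andP[_].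
  rewrite sum_ffun_ins => ->; rewrite mul1r big_ord_recl expr0 mul1r face_ins.
  congr (_ + _); rewrite -sumrN; apply: eq_bigr => i _.
  by rewrite face_lift0_ins lift0 exprS mulN1r mulNr.
move=> uzX; rewrite (ext_out _ uzX); move: uzX; rewrite is_osimplex_top sum_ffun_ins.
case: (_ \in A); last by rewrite mul0r.
rewrite andbT mul1r => /injectivePn uz; suff [l ul] : exists l, u = z l.
  rewrite (bigD1 l) //= big1 ?addr0 => [|i il].
    by rewrite -ext_ins ul ins_face subrr.
  rewrite ext_out ?mulr0 // is_osimplex_small //; apply/injectivePn.
  have [l'] := unlift_some il; rewrite /= => lE _.
  exists ord0, (lift ord0 l'); first exact: neq_lift.
  by rewrite ins_id ins_lift ffunE -lE.
case: uz => a [b]; case: (unliftP ord0 a) => [a' ->|->];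
  case: (unliftP ord0 b) => [b' ->|->]; rewrite ?ins_id ?ins_lift.
- by move=> ab /z_inj ab'; rewrite ab' eqxx in ab.
- by exists a'.
- by exists b'.
- by rewrite eqxx.
Qed.

Variables (I : finType) (i0 : I) (chi : I -> G -> R[i]).
Hypotheses (chiD : forall i g h, chi i (g + h) = chi i g * chi i h)
  (chi_norm : forall i g, `|chi i g| = 1) (chi0 : forall g, chi i0 g = 1)
  (chi_orth : forall g, \sum_i chi i g = (#|G| * (g == 0))%:R).
Variable lam : R[i].
Hypotheses (lam0 : 0 <= lam)
  (lamP : forall i, i != i0 -> `|\sum_(a in A) chi i a| <= lam).

(* The sum runs over all tuples, degenerate ones included: there the
   skew-symmetric extension of the coboundary vanishes by itself, so that each
   face has exactly [#|A|] completions. *)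
Lemma cdot_coboundary_sum_complex (phi : cochain R X k) :
  k`!%:R * cdot (coboundary R X k phi) (coboundary R X k phi) =
  #|A|%:R * (k`!%:R * cdot phi phi) -
  k%:R * \sum_(w : tup j) \sum_v \sum_u
     ext phi (ins ord0 v w) * (ext phi (ins ord0 u w))^*
       * (u + v + \sum_l w l \in A)%:R.
Proof.
rewrite cdot_coboundary cdot_ext.
transitivity (\sum_(z : tup k) (#|A|%:R * (ext phi z * (ext phi z)^*) -
  \sum_(i < k) \sum_u (-1) ^+ i * ext phi z * (ext phi (ins ord0 u (face i z)))^*
     * (u + \sum_l z l \in A)%:R)).
  apply: eq_bigr => z _.
  have [/injectiveP z_inj|z_ninj] := boolP (injectiveb z); last first.
    have zX : ~~ is_osimplex X z by rewrite is_osimplex_small.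
    rewrite !(ext_out _ zX) !mul0r mulr0 big1 ?subr0 // => i _.
    by rewrite big1 // => u _; rewrite mulr0 !mul0r.
  rewrite /link_sum; under eq_bigr => u _ do rewrite ext_coboundary_ins // mulrBr.
  rewrite sumrB rmorphB mulrBr /=; congr (_ - _).
    rewrite -mulr_suml rmorphM mulrCA; congr (_ * _).
    rewrite -natr_sum rmorph_nat; congr (_%:R).
    (* Translation by the sum of [z] shows that exactly [#|A|] vertices [u] complete it. *)
    rewrite (reindex_inj (addIr (- \sum_l z l))) /=.
    rewrite -sum1_card [RHS]big_mkcond; apply: eq_bigr => u _.
    by rewrite subrK; case: (u \in A).
  rewrite exchange_big rmorph_sum mulr_sumr; apply: eq_bigr => u _ /=.
  rewrite rmorphM rmorph_nat rmorph_sum !mulr_sumr; apply: eq_bigr => i _ /=.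
  by rewrite rmorphM rmorph_sign /=; ring.
rewrite sumrB -mulr_sumr; congr (_ - _).
(* Moving the entry [i] to the front squares its sign away, so all [k] positions give the same
   sum. *)
rewrite exchange_big (eq_bigr (fun=> \sum_(w : tup j) \sum_v \sum_u
     ext phi (ins ord0 v w) * (ext phi (ins ord0 u w))^*
       * (u + v + \sum_l w l \in A)%:R)) => [|i _] /=.
  by rewrite sumr_const card_ord mulr_natl.
rewrite (sum_ins i) exchange_big; apply: eq_bigr => w _.
apply: eq_bigr => v _; apply: eq_bigr => u _ /=.
rewrite face_ins sum_ffun_ins ext_ins addrA mulrA.
by rewrite -expr2 sqrr_sign mul1r.
Qed.

Lemma cdot_laplacian_ge (phi : cochain R X k) :
  (#|A|%:R - k%:R * lam) * cdot phi phi <= cdot (laplacian R X j phi) phi.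
Proof.
have f0 p : 0 < p`!%:R :> R[i] by rewrite ltr0n fact_gt0.
pose eta := adjoint (coboundary R X j) phi.
have eta_ge0 : 0 <= j`!%:R * cdot eta eta.
  by rewrite cdot_adjoint_coboundary sumr_ge0 // => z _; rewrite exprn_ge0.
have phi_sum : \sum_(w : tup j) \sum_v `|ext phi (ins ord0 v w)| ^+ 2
    = k`!%:R * cdot phi phi.
  rewrite cdot_ext (sum_ins ord0) exchange_big.
  by apply: eq_bigr => w _; apply: eq_bigr => v _; rewrite normCK.
have -> : cdot (laplacian R X j phi) phi =
    cdot eta eta + cdot (coboundary R X k phi) (coboundary R X k phi).
  rewrite /laplacian add_lfunE !comp_lfunE -/eta.
  have cdotD (x y : cochain R X k) : cdot (x + y) phi = cdot x phi + cdot y phi.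
    by have := cdot_linearl phi 1 x y; rewrite !scale1r.
  rewrite cdotD; congr (_ + _); first by rewrite adjointP.
  by rewrite cdotC -adjointP -cdotC.
rewrite -(ler_pM2l (f0 k)) mulrDr cdot_coboundary_sum_complex.
set T := \sum_(w : tup j) _.
(* For each [w], the Fourier bound applies to [ext phi (ins ord0 v w)] as a function of [v], shifted
   by the sum of [w]; its total over [v] is [link_sum phi w]. *)
have T_le : T <= #|A|%:R / #|G|%:R * (j`!%:R * cdot eta eta)
    + lam * (k`!%:R * cdot phi phi).
  rewrite cdot_adjoint_coboundary -phi_sum !mulr_sumr -big_split.
  by apply: ler_sum => w _; exact: sum_graph_form_le.
have A_le : #|A|%:R / #|G|%:R <= 1 :> R[i].
  rewrite ler_pdivrMr ?mul1r ?ler_nat ?max_card // ltr0n.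
  by apply/card_gt0P; exists 0.
(* The factor [k] matches the one before [T], so as [#|A| <= #|G|] the [eta] term of the Laplacian
   absorbs the trivial character. *)
have -> : k`!%:R * cdot eta eta = k%:R * (j`!%:R * cdot eta eta).
  by rewrite factS natrM mulrA.
rewrite mulrCA mulrBl addrCA -mulrA -mulrBr lerD2l -mulrN ler_wpM2l //.
rewrite lerBrDr addrC -lerBrDr opprK; apply: le_trans T_le _.
by rewrite lerD2r ler_piMl.
Qed.

End SumComplex.

(** * Smallest eigenvalue *)

Section Eigenvalues.

Lemma leigenvalueP (F : fieldType) (vT : vectType F) (f : 'End(vT)) a :
  reflect (exists2 v, v != 0 & f v = a *: v) (passmx.leigenvalue f a).
Proof.
have memE v : (v \in passmx.leigenspace f a) = (f v == a *: v).
  by rewrite memv_ker add_lfunE opp_lfunE scale_lfunE id_lfunE subr_eq0.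
apply: (iffP idP) => [|[v v0 /eqP]]; last first.
  by rewrite -memE; apply: contraTneq => ->; rewrite memv0.
rewrite /passmx.leigenvalue -vpick0 => v0.
exists (vpick (passmx.leigenspace f a)) => //.
by apply/eqP; rewrite -memE memv_pick.
Qed.

(** Ensures that [mu] is a genuine eigenvalue and not its default 0. The eigenvalues are the roots
    of the characteristic polynomial, a finite list that is nonempty since the space is nonzero. *)
Lemma ex_min_leigenvalue (R : realType) (vT : vectType R[i])
    (f : 'End(vT)) (v0 : vT) :
  v0 != 0 -> (forall a, passmx.leigenvalue f a -> a \is Num.real) ->
  exists x : R, passmx.leigenvalue f x%:C%C /\
    forall a, passmx.leigenvalue f a -> x%:C%C <= a.
Proof.
move=> v0_neq0 f_real; pose e := vbasis (fullv : {vspace vT}).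
pose p := char_poly (passmx.mxof e e f).
have leigE a : passmx.leigenvalue f a = root p a.
  rewrite -eigenvalue_root_char /passmx.leigenvalue.
  rewrite (passmx.leigenspaceE (vbasisP fullv)) passmx.vsof_eq0 //.
  exact: vbasisP.
have [r pE] := closed_field_poly_normal p.
rewrite (monicP (char_poly_monic _)) scale1r in pE.
have rootE a : root p a = (a \in r) by rewrite pE root_prod_XsubC.
have r0 : (0 < size r)%N.
  rewrite -ltnS -(size_prod_XsubC r id) -pE size_char_poly ltnS lt0n.
  by apply: contra v0_neq0; rewrite dimv_eq0 -memv0 => /eqP <-; rewrite memvf.
have real_r (i : 'I_(size r)) : r`_i = (complex.Re r`_i)%:C%C.
  by apply/esym/RRe_real/f_real; rewrite leigE rootE mem_nth.
pose i := [arg min_(i < Ordinal r0) complex.Re r`_i]%O.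
exists (complex.Re r`_i); split; first by rewrite -real_r leigE rootE mem_nth.
move=> a; rewrite leigE rootE => /(nthP 0)[l lr <-].
rewrite (real_r (Ordinal lr)) lecR /i.
by case: arg_minP => // i' _ /(_ (Ordinal lr)) ->.
Qed.

End Eigenvalues.

Section Mu.
Variables (R : realType) (V : finType) (X : simplicial_complex V).

Lemma cdot_gt0 p (phi : cochain R X p) : phi != 0 -> 0 < cdot phi phi.
Proof.
move=> phi0; have f0 : 0 < p`!%:R :> R[i] by rewrite ltr0n fact_gt0.
rewrite -(pmulr_rgt0 _ f0) cdot_ext lt_def; apply/andP; split; last first.
  by apply: sumr_ge0 => t _; rewrite mul_conjC_ge0.
apply: contra phi0; rewrite psumr_eq0 => [/allP e|t _]; last by rewrite mul_conjC_ge0.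
apply/eqP/val_inj/ffunP => t; rewrite -[LHS]/(ev phi t) -ext_val [RHS]ffunE.
by apply/eqP; rewrite -mul_conjC_eq0; exact: e (mem_index_enum _).
Qed.

(** Its value at [t] is 1, because only the identity reordering fixes [t]. *)
Lemma elem_neq0 p (t : osimplex X p) : elem R t != 0.
Proof.
apply/eqP => /(congr1 (fun phi => ev phi t)).
rewrite /ev /= !ffunE (bigD1 1%g) //= big1 => [|s s1].
  by rewrite reorder1 eqxx odd_perm1 addr0 mulr1 => /eqP; rewrite oner_eq0.
rewrite -{1}(reorder1 t) (inj_eq (@reorder_injl _ _ _ t)) eq_sym.
by rewrite (negPf s1) mulr0.
Qed.

End Mu.

Section MuSumComplex.
Variables (R : realType) (G : finZmodType) (A : {set G}) (j : nat).
Local Notation k := j.+1.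
Hypothesis kn : (k <= #|G|)%N.
Variables (I : finType) (i0 : I) (chi : I -> G -> R[i]).
Hypotheses (chiD : forall i g h, chi i (g + h) = chi i g * chi i h)
  (chi_norm : forall i g, `|chi i g| = 1) (chi0 : forall g, chi i0 g = 1)
  (chi_orth : forall g, \sum_i chi i g = (#|G| * (g == 0))%:R).

Lemma mu_sum_complex_ge (lam : R[i]) : 0 <= lam ->
  (forall i, i != i0 -> `|\sum_(a in A) chi i a| <= lam) ->
  #|A|%:R - k%:R * lam <= (mu R (sum_complex A k) j)%:C%C.
Proof.
move=> lam0 lamP.
have leig_ge a : passmx.leigenvalue (laplacian R (sum_complex A k) j) a ->
    #|A|%:R - k%:R * lam <= a.
  case/leigenvalueP => phi phi0 phiE.
  rewrite -(ler_pM2r (cdot_gt0 phi0)).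
  apply: le_trans (cdot_laplacian_ge chiD chi_norm chi0 chi_orth lam0 lamP phi) _.
  rewrite phiE; have := cdot_linearl phi a phi 0; rewrite addr0 => ->.
  have := cdot_linearl phi 1 0 0; rewrite !scale1r addr0.
  by rewrite -[X in X = _]addr0 => /addrI <-; rewrite addr0.
have real_lb : #|A|%:R - k%:R * lam \is Num.real.
  by rewrite rpredB ?rpredM ?realn // ger0_real.
(* The first [k] elements of [G] form a face by fullness of the skeleton, so the cochain space is
   nonzero. *)
pose t : {ffun 'I_k -> G} := [ffun i => enum_val (widen_ord kn i)].
have tX : is_osimplex (sum_complex A k) t.
  rewrite is_osimplex_small //; apply/injectiveP => x y.
  by rewrite !ffunE => /enum_val_inj/(congr1 val) /= /val_inj.
have [|x xP] := ex_min_leigenvalue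
    (elem_neq0 R (Sub t tX : osimplex (sum_complex A k) k)) _
    (f := laplacian R (sum_complex A k) j).
  (* In [R[i]], an element above a real one is real. *)
  by move=> a /leig_ge/ler_real <-.
apply: leig_ge; rewrite /mu; case: classical_sets.xgetP => [y _ []//|].
by move=> /(_ x)/(_ xP).
Qed.

End MuSumComplex.

(** * Union bound over the nontrivial characters *)

Section Probability.
Variables (R : realType) (G : finZmodType) (j m : nat) (eps : R).
Local Notation k := j.+1.
Local Notation n := #|G|.
Local Notation bad :=
  [set A : {set G} | mu R (sum_complex A k) j < (1 - eps) * m%:R].

Lemma Re_sum (T : Type) (r : seq T) (P : pred T) (f : T -> R[i]) :
  complex.Re (\sum_(i <- r | P i) f i) = \sum_(i <- r | P i) complex.Re (f i).
Proof. by apply: (big_morph (@complex.Re R)) => [[a b] [c d]|]. Qed.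

Lemma Im_sum (T : Type) (r : seq T) (P : pred T) (f : T -> R[i]) :
  complex.Im (\sum_(i <- r | P i) f i) = \sum_(i <- r | P i) complex.Im (f i).
Proof. by apply: (big_morph (@complex.Im R)) => [[a b] [c d]|]. Qed.

Lemma card_small_mu_le : 0 < eps -> (k <= n)%N -> (0 < m)%N ->
  #|[set A : {set G} | #|A| == m] :&: bad|%:R <=
  n%:R * (2 * expR (- ((eps * m%:R / k%:R) ^+ 2 / (2 * m%:R))) * 'C(n, m)%:R).
Proof.
move=> eps0 kn m0; pose t : R := eps * m%:R / k%:R.
have t0 : 0 <= t by rewrite divr_ge0 // mulr_ge0 // ltW.
have [I [i0 [chi [[cardI chiD chi_norm chi0] [chi_sum chi_orth]]]]] :=
  ex_dual_group R[i] G.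
pose x i g := complex.Re (chi i g); pose y i g := complex.Im (chi i g).
pose B i :=
  [set A : {set G} | (#|A| == m) && (t ^+ 2 < sqnorm_sum (x i) (y i) A)].
have B_le i : i != i0 -> #|B i|%:R <=
    2 * expR (- (t ^+ 2 / (2 * m%:R))) * 'C(n, m)%:R.
  move=> ii0; apply: sampling_tail => // [g||].
  - by have /(congr1 (@complex.Re R)) := add_Re2_Im2 (chi i g);
      rewrite chi_norm expr1n.
  - by rewrite -Re_sum chi_sum.
  - by rewrite -Im_sum chi_sum.
apply: (@le_trans _ _ (\sum_(i | i != i0) #|B i|%:R)).
  rewrite -natr_sum ler_nat.
  have union_le : (#|\bigcup_(i | i != i0) B i| <= \sum_(i | i != i0) #|B i|)%N.
    elim/big_rec2: _ => [|i s S _ IH]; first by rewrite cards0.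
    by rewrite (leq_trans (leq_card_setU _ _)) ?leq_add2l.
  apply: leq_trans union_le; apply/subset_leq_card/subsetP => A.
  rewrite !inE => /andP[/eqP Am].
  apply: contraTT; rewrite -leNgt => notB.
  (* Hence the spectral bound [m - k * t] is exactly [(1 - eps) * m]. *)
  have tk : (t * k%:R) = eps * m%:R by rewrite divfK // pnatr_eq0.
  have small i : i != i0 -> `|\sum_(a in A) chi i a| <= t%:C%C.
    move=> ii0; rewrite -ler_sqr ?nnegrE ?normr_ge0 //; last by rewrite lecR.
    rewrite -add_Re2_Im2 -rmorphXn lecR.
    rewrite Re_sum Im_sum leNgt; apply: contra notB => h.
    by apply/bigcupP; exists i => //; rewrite inE Am eqxx.
  have := mu_sum_complex_ge kn chiD chi_norm chi0 chi_orth (_ : 0 <= t%:C%C) small.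
  rewrite lecR Am => /(_ t0).
  rewrite -(rmorph_nat (real_complex R)) -(rmorph_nat (real_complex R) k).
  by rewrite -rmorphM -rmorphB lecR mulrC tk mulrBl mul1r.
apply: le_trans (ler_sum _ B_le) _; rewrite sumr_const -[leLHS]mulr_natl.
apply: ler_wpM2r; last by rewrite ler_nat -cardI max_card.
by rewrite !mulr_ge0 ?expR_ge0.
Qed.
End Probability.

Theorem theorem1p2 (R : realType) (k : nat) (eps : R) (G : finZmodType)
    (n m : nat) :
  (1 <= k)%N -> 0 < eps -> #|G| = n ->
  2 ^+ 10 * k%:R ^+ 8 / eps ^+ 8 < n%:R -> (k < n)%N ->
  m%:Z = Num.ceil (4 * k%:R ^+ 2 * ln (n%:R : R) / eps ^+ 2) ->
  uniform_pr R [set A : {set G} | #|A| == m]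
    [set A : {set G} | mu R (sum_complex A k) k.-1 < (1 - eps) * m%:R]
  < 6 / n%:R.
Proof.
case: k => // j _ eps0 nE _ kn mE /=.
have n0 : 0 < n%:R :> R by rewrite ltr0n; apply: leq_ltn_trans kn.
have k0 : 0 < j.+1%:R :> R by rewrite ltr0n.
have ln_n : 0 < ln (n%:R : R) by rewrite ln_gt0 // ltr1n (leq_ltn_trans _ kn).
have m_ge : 4 * j.+1%:R ^+ 2 * ln (n%:R : R) / eps ^+ 2 <= m%:R.
  by have := ceil_ge (4 * j.+1%:R ^+ 2 * ln (n%:R : R) / eps ^+ 2); rewrite -mE.
have mR : 0 < m%:R :> R.
  by apply: lt_le_trans m_ge; rewrite divr_gt0 ?mulr_gt0 ?exprn_gt0.
(* With [k = j.+1], the exponent is [m * eps ^+ 2 / (2 * k ^+ 2)] up to sign, at least [2 * ln n] by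
   the choice of [m]. *)
have tail : expR (- ((eps * m%:R / j.+1%:R) ^+ 2 / (2 * m%:R))) <= n%:R ^- 2.
  move: (j.+1%:R : R) k0 m_ge => K K0 m_ge.
  have c0 : 0 <= eps ^+ 2 / (2 * K ^+ 2).
    by rewrite divr_ge0 ?mulr_ge0 ?exprn_ge0 // ltW.
  rewrite -[n%:R in leRHS]lnK ?posrE // -expRM_natl -expRN ler_expR lerN2.
  have -> : (eps * m%:R / K) ^+ 2 / (2 * m%:R) = m%:R * (eps ^+ 2 / (2 * K ^+ 2)).
    by field; rewrite !gt_eqF.
  apply: le_trans (ler_wpM2r c0 m_ge); rewrite le_eqVlt; apply/orP; left.
  by apply/eqP; field; rewrite !gt_eqF.
rewrite /uniform_pr card_draws nE.
(* If [m] exceeds [n], no set has size [m], and the probability is 0 because division by zero gives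
   0. *)
have [C0|C0] := posnP 'C(n, m); first by rewrite C0 invr0 mulr0 divr_gt0.
have CR : 0 < 'C(n, m)%:R :> R by rewrite ltr0n.
rewrite ltr_pdivrMr //.
apply: le_lt_trans (card_small_mu_le eps0 _ _) _; rewrite ?nE ?(ltnW kn) //.
  by rewrite -(ltr0n R).
rewrite mulrA ltr_pM2r //.
apply: (@le_lt_trans _ _ (n%:R * (2 * n%:R ^- 2))).
  by rewrite ler_pM2l // ler_pM2l.
have -> : n%:R * (2 * n%:R ^- 2) = 2 / n%:R :> R by field; rewrite gt_eqF.
by rewrite ltr_pM2r ?invr_gt0 // ltr_nat.
Qed.
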